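(* The linearithmic deterministic identification capacity of the Bernoulli channel $B$ is $\dot C_{\mathrm{DI}}(B)=\frac12$.
   Context: The Bernoulli channel $B$ has input alphabet $\mathcal X=[0,1]$ and output alphabet $\mathcal Y=\{0,1\}$, with $B(1|x)=x$ and $B(0|x)=1-x$. Channels are memoryless: on input $x^n=(x_1,\dots,x_n)\in\mathcal X^n$, the output $Y^n$ has independent coordinates with $Y_i\sim W(\cdot|x_i)$; the resulting law is denoted $W^n(\cdot|x^n)$. An $(n,N,\lambda_1,\lambda_2)$ deterministic identification (DI) code for a channel $W:\mathcal X\to\mathcal Y$ is a family $\{(u_i,\mathcal D_i): i\in[N]\}$ with $u_i\in\mathcal X^n$ and $\mathcal D_i\subset\mathcal Y^n$ (regions may overlap) such that for all distinct $i,j\in[N]$: $W^n(\mathcal D_i|u_i)\ge 1-\lambda_1$ and $W^n(\mathcal D_j|u_i)\le\lambda_2$. A number $\dot R>0$ is an achievable linearithmic rate for $W$ if there is a sequence of $(n,N^{(n)},\lambda_1^{(n)},\lambda_2^{(n)})$ DI codes with $\lambda_1^{(n)},\lambda_2^{(n)}\to0$ and $\frac{\log N^{(n)}}{n\log n}\to\dot R$ as $n\to\infty$. The linearithmic DI capacity $\dot C_{\mathrm{DI}}(W)$ is the largest achievable linearithmic rate. *)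

(* Defs.v *)
From HB Require Import structures.
From mathcomp Require Import all_boot all_order all_algebra.
From mathcomp Require Import all_classical all_reals all_analysis.

Set Implicit Arguments.
Unset Strict Implicit.
Unset Printing Implicit Defensive.

Import Order.TTheory GRing.Theory Num.Theory.
Import numFieldNormedType.Exports.

Local Open Scope classical_set_scope.
Local Open Scope ring_scope.

(* [W x y] is the transition probability W(y|x). *)
Record channel (R : realType) (X : Type) (Y : finType) := Channel {
  transition :> X -> Y -> R ;
  transition_ge0 : forall x y, 0 <= transition x y ;
  transition_sum1 : forall x, \sum_(y : Y) transition x y = 1 }.

(* W^n(D|x^n), for the memoryless extension W^n of W. *)
Definition channel_pow (R : realType) (X : Type) (Y : finType)
    (W : channel R X Y) (n : nat) (x : n.-tuple X) (D : {set n.-tuple Y}) : R :=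
  \sum_(y in D) \prod_(k < n) W (tnth x k) (tnth y k).

Record DI_code (R : realType) (X : Type) (Y : finType) (W : channel R X Y)
    (n N : nat) (lambda1 lambda2 : R) := DICode {
  codeword : 'I_N -> n.-tuple X ;
  region : 'I_N -> {set n.-tuple Y} ;
  DI_code_errors : forall i j : 'I_N, i != j ->
    channel_pow W (codeword i) (region i) >= 1 - lambda1 /\
    channel_pow W (codeword i) (region j) <= lambda2 }.

(* The base of the logarithm cancels in log N / (n log n). The values at
   n = 0, 1, where the denominator vanishes, do not affect the limit. *)
Definition achievable_linearithmic_rate (R : realType) (X : Type)
    (Y : finType) (W : channel R X Y) (r : R) : Prop :=
  0 < r /\
  exists (N : nat -> nat) (lambda1 lambda2 : nat -> R)
         (_ : forall n, DI_code W n (N n) (lambda1 n) (lambda2 n)),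
    [/\ lambda1 n @[n --> \oo] --> (0 : R),
        lambda2 n @[n --> \oo] --> (0 : R) &
        ln (N n)%:R / (n%:R * ln n%:R) @[n --> \oo] --> r].

(* A largest achievable rate need not exist for an arbitrary channel, so the
   capacity is a relation: [c] is the maximum of the achievable rates. *)
Definition is_linearithmic_DI_capacity (R : realType) (X : Type)
    (Y : finType) (W : channel R X Y) (c : R) : Prop :=
  achievable_linearithmic_rate W c /\
  ubound [set r | achievable_linearithmic_rate W r] c.

(* [{i01 R}] is the interval [0, 1]; the outputs 1 and 0 are [true] and
   [false], and [bernoulli_pmf x y] is [if y then x else 1 - x]. *)
Section bernoulli_channel.
Variable R : realType.

Lemma bernoulli_transition_ge0 (x : {i01 R}) (y : bool) :
  0 <= bernoulli_pmf x%:num y.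
Proof. by apply: bernoulli_pmf_ge0; rewrite ge0 le1. Qed.

Lemma bernoulli_transition_sum1 (x : {i01 R}) :
  \sum_(y : bool) bernoulli_pmf x%:num y = 1.
Proof. by rewrite big_bool /= addrC subrK. Qed.

Definition bernoulli_channel : channel R {i01 R} bool :=
  Channel bernoulli_transition_ge0 bernoulli_transition_sum1.

End bernoulli_channel.

(* Main.v *)
(* Achievability.  Codewords are x = v / b^p with v written in base b = 2q, only
   the digits 0..q-1 being allowed, and the words formed by the digits of each
   significance l taken from a Gilbert-Varshamov code, so that distinct digit
   words differ in at least n/p positions.  Let w_l be the part of v below
   b^(l+1).  By pigeonhole, at the cost of a factor n^(2p), all codewords
   share the norms |w_l|^2 for every l.  The region of codeword j accepts when
   all the linear statistics <w_l(j), y - x_j> are small.  If l is the most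
   significant level at which i and j differ, equality of norms gives
     <w_l(j), v_j - v_i> = |w_l(j) - w_l(i)|^2 / 2,
   a shift proportional to n b^(2l) / p that is untouched by the digits below
   l, whereas the noise has standard deviation at most sqrt n b^(l+1).  So a
   spacing b^(-p) only slightly larger than n^(-1/2) suffices; with
   b = 2^(2p+1) and n about 2^(4p^2), log N is about (n log n) / 2.

   Converse.  Codewords whose coordinates lie in the same cells, where the cells
   are intervals of length of order n^(-1/2) for sqrt(min(x, 1-x)) on either
   half of [0,1], have Bhattacharyya coefficient at least 3/4, and so cannot be
   told apart.  There are O(sqrt n) cells, whence N <= (6 sqrt n)^n. *)

Require Import Defs.
From mathcomp Require Import all_boot all_order all_algebra.
From mathcomp Require Import all_classical all_reals all_analysis.
From mathcomp Require Import ring lra zify.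

Set Implicit Arguments.
Unset Strict Implicit.
Unset Printing Implicit Defensive.

Import Order.TTheory GRing.Theory Num.Theory.
Import numFieldNormedType.Exports.

Local Open Scope ring_scope.

(** * Memoryless channels *)

Lemma sum_tuple_prod (R : comPzRingType) (Y : finType) (n : nat)
    (F : 'I_n -> Y -> R) :
  \sum_(y : n.-tuple Y) \prod_(k < n) F k (tnth y k) =
  \prod_(k < n) \sum_(b : Y) F k b.
Proof.
rewrite bigA_distr_bigA /= (reindex (fun f : {ffun 'I_n -> Y} => [tuple f k | k < n])) /=.
  by apply: eq_bigr => f _; apply: eq_bigr => k _; rewrite tnth_mktuple.
exists (fun y : n.-tuple Y => [ffun k => tnth y k]) => y _.
  by apply/ffunP => k; rewrite ffunE tnth_mktuple.
by apply: eq_from_tnth => k; rewrite tnth_mktuple ffunE.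
Qed.

Section channel_pow_theory.
Variables (R : realType) (X : Type) (Y : finType) (W : channel R X Y).
Variables (n : nat) (x : n.-tuple X).
Implicit Types A B D : {set n.-tuple Y}.

Lemma channel_pow_prod_ge0 (y : n.-tuple Y) :
  0 <= \prod_(k < n) W (tnth x k) (tnth y k).
Proof. by apply: prodr_ge0 => k _; exact: transition_ge0. Qed.

Lemma channel_powT : channel_pow W x (finset.setTfor _) = 1.
Proof.
rewrite /channel_pow (eq_bigl predT) => [|y]; last by rewrite inE.
rewrite (sum_tuple_prod (fun k b => W (tnth x k) b)).
by rewrite big1 // => k _; exact: transition_sum1.
Qed.

Lemma channel_powC D : channel_pow W x (~: D) = 1 - channel_pow W x D.
Proof.
by rewrite -channel_powT /channel_pow [in RHS](big_setID D) /= finset.setTI finset.setTD addrAC subrr add0r.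
Qed.

Lemma le_channel_pow A B :
  (A \subset B) -> channel_pow W x A <= channel_pow W x B.
Proof.
move=> AB; rewrite /channel_pow [leRHS](big_setID A) /= (finset.setIidPr AB).
by rewrite lerDl sumr_ge0 // => y _; exact: channel_pow_prod_ge0.
Qed.

(** Markov's inequality, with the bound kept in the product form [e * t] to avoid a division. *)
Lemma channel_pow_markov (f : n.-tuple Y -> R) (t e : R) D :
  (forall y, 0 <= f y) -> (forall y, y \in D -> t <= f y) -> 0 < t ->
  \sum_(y : n.-tuple Y) (\prod_(k < n) W (tnth x k) (tnth y k)) * f y <= e * t ->
  channel_pow W x D <= e.
Proof.
move=> f0 fD t0 H; rewrite -(ler_pM2r t0); apply: le_trans H.
rewrite [leRHS](bigID (mem D)) /= -[leLHS]addr0 lerD ?sumr_ge0//.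
  rewrite /channel_pow mulr_suml ler_sum // => y yD.
  by rewrite ler_wpM2l ?channel_pow_prod_ge0 ?fD.
by move=> y _; rewrite mulr_ge0 ?channel_pow_prod_ge0.
Qed.

End channel_pow_theory.

(** * Linear statistics of the Bernoulli output *)

Section bernoulli.
Variables (R : realType) (n : nat) (x : n.-tuple {i01 R}).
Local Notation B := (bernoulli_channel R).
Local Notation xr k := ((tnth x k)%:num : R).

Lemma bernoulli_covariance (k l : 'I_n) :
  \sum_(y : n.-tuple bool) (\prod_(m < n) B (tnth x m) (tnth y m)) *
    (((tnth y k)%:R - xr k) * ((tnth y l)%:R - xr l)) =
  (k == l)%:R * (xr k * (1 - xr k)).
Proof.
(* The centred [j]-th output becomes a product over all positions, with factor 1 away from [j], so
   that [sum_tuple_prod] factors the expectation. *)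
pose g (j m : 'I_n) (b : bool) : R := if m == j then b%:R - xr m else 1.
have gE j (y : n.-tuple bool) : \prod_(m < n) g j m (tnth y m) = (tnth y j)%:R - xr j.
  rewrite (bigD1 j) //= /g eqxx big1 ?mulr1 // => m /negbTE ->; done.
under eq_bigr do rewrite -!gE -!big_split /=.
have e1 : true%:R = 1 :> R by [].
have e0 : false%:R = 0 :> R by [].
rewrite (sum_tuple_prod (fun m b => B (tnth x m) b * (g k m b * g l m b))).
rewrite (bigD1 k) //= big_bool /= /g eqxx.
have [<-|kl] := eqVneq k l.
  rewrite big1 => [|m mk]; first by rewrite ?e1 ?e0; ring.
  rewrite big_bool /= (negbTE mk) /=; ring.
rewrite /=; rewrite ?e1 ?e0; ring.
Qed.

(** Only diagonal covariances survive in the variance, and each factor $x(1-x)$ is bounded crudely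
    by 1. *)
Lemma bernoulli_chebyshev (a : 'I_n -> R) (t e : R) :
  0 < t -> \sum_(k < n) a k ^+ 2 <= e * t ^+ 2 ->
  channel_pow B x
    [set y : n.-tuple bool | t <= `|\sum_(k < n) a k * ((tnth y k)%:R - xr k)|] <= e.
Proof.
move=> t0 H.
apply: (@channel_pow_markov R _ _ B n x
  (fun y : n.-tuple bool => (\sum_(k < n) a k * ((tnth y k)%:R - xr k)) ^+ 2) (t ^+ 2)).
- by move=> y; exact: sqr_ge0.
- move=> y; rewrite inE => ty; rewrite -(real_normK (num_real (\sum_(k < n) _))).
  by rewrite ler_pXn2r // nnegrE ?normr_ge0 // ltW.
- by rewrite exprn_gt0.
apply: le_trans H.
have E y : (\prod_(m < n) B (tnth x m) (tnth y m)) *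
    (\sum_(k < n) a k * ((tnth y k)%:R - xr k)) ^+ 2 =
  \sum_(k < n) \sum_(l < n) a k * a l * ((\prod_(m < n) B (tnth x m) (tnth y m)) *
    (((tnth y k)%:R - xr k) * ((tnth y l)%:R - xr l))).
  rewrite expr2 big_distrlr mulr_sumr /=; apply: eq_bigr => k _.
  rewrite mulr_sumr; apply: eq_bigr => l _.
  by rewrite (mulrACA (a k) _ (a l)) [LHS]mulrCA.
rewrite (eq_bigr _ (fun y _ => E y)).
rewrite exchange_big ler_sum //= => k _; rewrite exchange_big /=.
under eq_bigr do rewrite -mulr_sumr bernoulli_covariance.
rewrite (bigD1 k) //= eqxx big1 => [|l]; last by rewrite eq_sym => /negbTE ->; rewrite mul0r mulr0.
rewrite addr0 mul1r -expr2 ler_piMr ?sqr_ge0 //.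
Qed.

End bernoulli.

(** * Codes with common low-part norms *)

Section hamming.
Variables (I Y : finType).
Implicit Types f g : {ffun I -> Y}.
Local Open Scope nat_scope.

Definition disagreement f g : {set I} := [set k | f k != g k].

(** Sort the words [g] by the set where they differ from [f]: there are at most [2 ^ #|I|] such
    sets, and [g] is free only on its own, of size at most [r]. *)
Lemma card_hamming_ball f (r : nat) : 0 < #|Y| ->
  #|[set g | #|disagreement f g| <= r]| <= 2 ^ #|I| * #|Y| ^ r.
Proof.
move=> Y0; rewrite -sum1_card.
rewrite (partition_big (disagreement f) (fun S : {set I} => #|S| <= r)) /=; last first.
  by move=> g; rewrite inE.
apply: (@leq_trans (\sum_(S : {set I} | #|S| <= r) #|Y| ^ r)).
  apply: leq_sum => S Sr; rewrite sum1dep_card.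
  pose F k : pred Y := if k \in S then predT else pred1 (f k).
  apply: (@leq_trans #|family F|).
    apply: subset_leq_card; apply/fintype.subsetP => g; rewrite !inE => /andP[_ /eqP e].
    apply/familyP => k; rewrite /F -e !inE; case: eqVneq => //= ->.
    by rewrite inE eqxx.
  rewrite card_family foldrE big_map big_enum /= (bigID (mem S)) /=.
  rewrite [X in _ * X]big1 ?muln1 => [|k /negbTE kS]; last by rewrite /F kS card1.
  rewrite (eq_bigr (fun=> #|Y|)) => [|k kS]; last by rewrite /F kS.
  by rewrite prod_nat_const leq_pexp2l.
rewrite sum_nat_cond_const leq_mul2r; apply/orP; right.
by rewrite -cardsT -card_powerset subset_leq_card // powersetT finset.subsetT.
Qed.

(** Take a maximal separated set. A word farther than [r] from all its members could be added, so
    its balls of radius [r] cover the space. *)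
Lemma gilbert_varshamov (r : nat) : 0 < #|Y| ->
  exists2 C : {set {ffun I -> Y}},
    {in C &, forall f g, f != g -> r < #|disagreement f g|} &
    #|Y| ^ #|I| <= #|C| * (2 ^ #|I| * #|Y| ^ r).
Proof.
move=> Y0.
pose P (C : {set {ffun I -> Y}}) :=
  [forall f in C, forall g in C, (f != g) ==> (r < #|disagreement f g|)].
have PP C : P C -> {in C &, forall f g, f != g -> r < #|disagreement f g|}.
  by move=> /forall_inP H f g /H /forall_inP H1 /H1 /implyP.
have : P finset.set0 by apply/forall_inP => f; rewrite inE.
move=> /maxset_exists[C /maxsetP[PC maxC] _]; exists C; first exact: PP.
rewrite -card_ffun -[X in X <= _]cardsT.
apply: (@leq_trans #|\bigcup_(f in C) [set g | #|disagreement f g| <= r]|).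
  apply/subset_leq_card/fintype.subsetP => g _; apply/bigcupP.
  have [[f fC fg]|H] := pselect (exists2 f, f \in C & #|disagreement f g| <= r).
    by exists f => //; rewrite inE.
  have far f : f \in C -> r < #|disagreement f g|.
    by move=> fC; rewrite ltnNge; apply/negP => fg; apply: H; exists f.
  have gC : g \in C.
    suff <- : (g |: C)%SET = C by rewrite setU11.
    apply: maxC; last by rewrite finset.subsetUr.
    apply/forall_inP => f1 /finset.setU1P[->|f1C]; apply/forall_inP => f2 /finset.setU1P[->|f2C].
    - by rewrite eqxx.
    - apply/implyP => _; have := far _ f2C; rewrite /disagreement.
      by under eq_finset do rewrite eq_sym.
    - by rewrite far // implybT.
    - by apply/implyP; exact: (PP _ PC).
  exists g => //; rewrite inE /disagreement.
  by under eq_finset do rewrite eqxx; rewrite -[X in X <= _]/#|[set _ | false]| cards0.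
have sub (F : {ffun I -> Y} -> {set {ffun I -> Y}}) :
    #|\bigcup_(f in C) F f| <= \sum_(f in C) #|F f|.
  elim/big_rec2: _ => [|f m S _ H]; first by rewrite cards0.
  by rewrite (leq_trans (leq_card_setU _ _)) ?leq_add2l.
apply: leq_trans (sub _) _; rewrite -sum_nat_const; apply: leq_sum => f _.
exact: card_hamming_ball.
Qed.

End hamming.

Lemma pigeonhole_fiber (T S : finType) (A : {set T}) (f : T -> S) :
  (0 < #|S| -> exists v, #|A| <= #|S| * #|[set x in A | f x == v]|)%N.
Proof.
move=> S0; have [v Hv] := @bigop.eq_bigmax S (fun v => #|[set x in A | f x == v]|) S0.
exists v; rewrite -sum1_card (partition_big f predT) //= -sum_nat_const.
apply: leq_sum => u _; rewrite sum1dep_card -Hv.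
exact: (bigop.leq_bigmax_cond (F := fun v => #|[set x in A | f x == v]|)).
Qed.

(** * Base-[b] expansions with small digits *)

Section digits.
Variable b : nat.
Implicit Types a : nat -> nat.
Local Open Scope nat_scope.

Definition low_part a l := \sum_(m < l) a m * b ^ m.

Lemma low_partS a l : low_part a l.+1 = low_part a l + a l * b ^ l.
Proof. by rewrite /low_part big_ord_recr. Qed.

(** Digits of at most $b/2-1$ keep the value below half of [b ^ l]; [low_part_gap] rests on this
    slack. *)
Lemma low_part_lt a l : (forall m, 2 * a m + 2 <= b) ->
  2 * low_part a l < b ^ l.
Proof.
move=> Hb; elim: l => [|l IH]; first by rewrite /low_part big_ord0.
rewrite low_partS expnS.
have := leq_mul (Hb l) (leqnn (b ^ l)); move: (b ^ l) IH => B.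
rewrite mulnDl -mulnA; lia.
Qed.

(** The larger digit gains at least [2 * b ^ l] in the doubled difference, and the digits below
    level [l] take back less than [b ^ l]. *)
Lemma low_part_gap a a' l : (forall m, 2 * a' m + 2 <= b) -> a' l < a l ->
  b ^ l + 2 * low_part a' l.+1 <= 2 * low_part a l.+1.
Proof.
move=> Hb aa'; rewrite !low_partS; have := low_part_lt l Hb.
have := leq_mul aa' (leqnn (b ^ l)); rewrite mulSn; lia.
Qed.

(** Common digits cancel in the difference of the two numbers; sums are used because subtraction on
    [nat] truncates. *)
Lemma low_part_agree a a' l p : l <= p ->
  (forall m, l <= m < p -> a m = a' m) ->
  low_part a p + low_part a' l = low_part a' p + low_part a l.
Proof.
elim: p => [|p IH]; first by rewrite leqn0 => /eqP ->; lia.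
rewrite leq_eqVlt => /orP[/eqP <-|]; first by lia.
rewrite ltnS => lp H; rewrite !low_partS (H p) ?lp ?ltnSn //.
suff : low_part a p + low_part a' l = low_part a' p + low_part a l by lia.
by apply: IH => // m /andP[lm mp]; rewrite H // lm ltnW.
Qed.

End digits.

(** Choosing each of the [p] digit words in a Gilbert-Varshamov code [C] gives [#|C| ^ p] arrays.
    The [p] squared norms are at most [K], so fixing them all costs a factor [K.+1 ^ p], and
    [M * K.+1 <= #|C|]. *)
Lemma hierarchical_code (n q p r M K : nat) : (0 < q)%N ->
  (n * (2 * q) ^ (2 * p) <= K)%N -> (M * K.+1 * (2 ^ n * q ^ r) <= q ^ n)%N ->
  exists c : 'I_(M ^ p) -> 'I_n -> nat -> nat,
   [/\ forall i k m, (2 * c i k m + 2 <= 2 * q)%N,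
       forall i j l, (l < p)%N ->
         (\sum_(k < n) low_part (2 * q) (c i k) l.+1 ^ 2 =
          \sum_(k < n) low_part (2 * q) (c j k) l.+1 ^ 2)%N &
       forall i j, i != j -> exists l,
         [/\ (l < p)%N, (r < #|[set k | c i k l != c j k l]|)%N &
             forall k m, (l < m < p)%N -> c i k m = c j k m]].
Proof.
move=> q0 HK HM.
have [|C Csep Ccard] := @gilbert_varshamov 'I_n 'I_q r; first by rewrite card_ord.
rewrite !card_ord in Ccard.
pose T := {ffun 'I_p -> {ffun 'I_n -> 'I_q}}.
(* Digits of significance [p] or more default to 0. *)
pose dig (a : T) (k : 'I_n) (m : nat) : nat :=
  oapp (fun m' : 'I_p => nat_of_ord (a m' k)) 0%N (insub m).
have digE a k (m : 'I_p) : dig a k m = a m k.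
  by rewrite /dig valK.
have dig_lt a k m : (2 * dig a k m + 2 <= 2 * q)%N.
  have : (dig a k m < q)%N by rewrite /dig; case: insubP => [m' _ _|_] /=.
  lia.
pose A : {set T} := [set a in ffun_on (mem C)].
have cardA : #|A| = (#|C| ^ p)%N by rewrite cardsE card_ffun_on card_ord.
pose sq (a : T) l := (\sum_(k < n) low_part (2 * q) (dig a k) l.+1 ^ 2)%N.
have sq_le a l : (l < p)%N -> (sq a l <= K)%N.
  move=> lp; apply: leq_trans HK; rewrite -[X in (_ <= X * _)%N]card_ord -sum_nat_const.
  apply: leq_sum => k _; have := @low_part_lt _ (dig a k) l.+1 (dig_lt a k) => H.
  rewrite [(2 * p)%N]mulnC expnM leq_sqr; apply: (@leq_trans ((2 * q) ^ l.+1)); first by lia.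
  by rewrite leq_pexp2l // muln_gt0.
pose f (a : T) : {ffun 'I_p -> 'I_K.+1} := [ffun l : 'I_p => inord (sq a l)].
have [|v Hv] := @pigeonhole_fiber _ _ A f.
  by rewrite card_ffun !card_ord expn_gt0.
rewrite card_ffun !card_ord cardA in Hv.
set F := [set _ in A | _] in Hv.
have MF : (M ^ p <= #|F|)%N.
  rewrite -(@leq_pmul2l (K.+1 ^ p)) ?expn_gt0 //.
  apply: leq_trans Hv; rewrite mulnC -expnMn.
  have MC : (M * K.+1 <= #|C|)%N.
    by move: (leq_trans HM Ccard); rewrite leq_pmul2r // muln_gt0 !expn_gt0 q0.
  by case: (p) => // p'; rewrite leq_exp2r.
pose w i : T := enum_val (widen_ord MF i).
have wF i : w i \in F by exact: enum_valP.
exists (fun i => dig (w i)); split.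
- by move=> i k m; exact: dig_lt.
- move=> i j l lp; rewrite -!/(sq _ _).
  have := wF i; rewrite inE => /andP[_ /eqP/ffunP/(_ (Ordinal lp))].
  have := wF j; rewrite inE => /andP[_ /eqP/ffunP/(_ (Ordinal lp)) <-].
  rewrite !ffunE /= => /(congr1 val) /=.
  by rewrite !inordK ?ltnS ?sq_le.
- move=> i j ij.
  have wij : w i != w j.
    by apply: contraNneq ij => /enum_val_inj/(congr1 val)/= e; apply/eqP/val_inj.
  have [m0 Hm0] : exists m, w i m != w j m.
    apply/existsP; rewrite -negb_forall; apply: contraNN wij => /forallP H.
    by apply/eqP/ffunP => m; apply/eqP.
  (* The witness is the most significant level at which the two arrays differ. *)
  case: (@arg_maxnP _ m0 (fun m => w i m != w j m) val Hm0) => l Hl maxl.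
  exists l; split => //.
  + have inC i' : w i' l \in C.
      by have := wF i'; rewrite inE => /andP[]; rewrite inE => /ffun_onP.
    have := Csep _ _ (inC i) (inC j) Hl; rewrite /disagreement.
    by under eq_finset do rewrite -!(inj_eq val_inj) /= -!digE.
  + move=> k m /andP[lm mp]; rewrite -[m]/(val (Ordinal mp)) !digE.
    suff -> : w i (Ordinal mp) = w j (Ordinal mp) by [].
    apply: contraTeq lm => H.
    by rewrite -leqNgt; exact: (maxl (Ordinal mp) H).
Qed.

(** * Achievability *)

Lemma channel_powU (R : realType) (X : Type) (Y : finType) (W : channel R X Y)
    (n : nat) (x : n.-tuple X) (A B : {set n.-tuple Y}) :
  channel_pow W x (A :|: B)%SET <= channel_pow W x A + channel_pow W x B.
Proof.
rewrite {1}/channel_pow (big_setID A) /= lerD //; apply: le_channel_pow.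
  exact: finset.subsetIr.
by rewrite finset.setDUl finset.setDv finset.set0U finset.subsetDl.
Qed.

Lemma channel_pow_bigcup (R : realType) (X : Type) (Y : finType)
    (W : channel R X Y) (n : nat) (x : n.-tuple X) (I : finType)
    (A : I -> {set n.-tuple Y}) (e : R) :
  (forall i, channel_pow W x (A i) <= e) ->
  channel_pow W x (\bigcup_i A i)%SET <= #|I|%:R * e.
Proof.
move=> Ae; apply: (@le_trans _ _ (\sum_(i : I) channel_pow W x (A i))).
  elim/big_rec2: _ => [|i a D _ aD]; first by rewrite /channel_pow big_set0.
  by rewrite (le_trans (channel_powU _ _ _ _)) // lerD2l.
rewrite mulr_natl -sumr_const; exact: ler_sum.
Qed.

(** A region asks all [p] statistics to stay within their thresholds. The union bound gives
    [p%:R * e] for a missed identification; for a false one, a single well-shifted statistic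
    suffices. The [exists _, True] form makes inhabitation of a record type a proposition. *)
Lemma DI_code_of_linear_tests (R : realType) (n N p : nat)
    (x : 'I_N -> n.-tuple {i01 R}) (g : 'I_N -> 'I_p -> 'I_n -> R)
    (t : 'I_p -> R) (e lambda : R) :
  p%:R * e <= lambda -> e <= lambda -> (forall l, 0 < t l) ->
  (forall j l, \sum_(k < n) g j l k ^+ 2 <= e * t l ^+ 2) ->
  (forall i j, i != j -> exists l, 2 * t l <=
     \sum_(k < n) g j l k * ((tnth (x j) k)%:num - (tnth (x i) k)%:num)) ->
  exists _ : DI_code (bernoulli_channel R) n N lambda lambda, True.
Proof.
move=> pe el t0 gt sep.
pose S j l i (y : n.-tuple bool) : R :=
  \sum_(k < n) g j l k * ((tnth y k)%:R - (tnth (x i) k)%:num).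
pose D j : {set n.-tuple bool} := [set y | [forall l, `|S j l j y| < t l]]%SET.
suff H : forall i j, i != j ->
    channel_pow (bernoulli_channel R) (x i) (D i) >= 1 - lambda /\
    channel_pow (bernoulli_channel R) (x i) (D j) <= lambda.
  by exists (DICode H).
move=> i j ij; split.
  rewrite -[D i]finset.setCK channel_powC lerD2l lerN2; apply: le_trans pe.
  rewrite -[X in X%:R]card_ord; apply: le_trans (channel_pow_bigcup
    (A := fun l => [set y : n.-tuple bool | t l <= `|S i l i y|]%SET) _); last first.
    by move=> l; exact: bernoulli_chebyshev.
  apply: le_channel_pow; apply/fintype.subsetP => y; rewrite !inE negb_forall.
  by move=> /existsP[l]; rewrite -leNgt => H; apply/bigcupP; exists l; rewrite ?inE.
have [l Hl] := sep _ _ ij; apply: le_trans el.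
apply: le_trans (@bernoulli_chebyshev R n (x i) _ _ _ (t0 l) (gt j l)).
apply: le_channel_pow; apply/fintype.subsetP => y; rewrite !inE => /forallP/(_ l).
(* Recentring at the true input [x i] adds a shift of at least [2 * t l]; acceptance by [j] then
   forces a deviation of at least [t l]. *)
have -> : \sum_(k < n) g j l k * ((tnth y k)%:R - (tnth (x i) k)%:num) =
   S j l j y + \sum_(k < n) g j l k * ((tnth (x j) k)%:num - (tnth (x i) k)%:num).
  by rewrite -big_split; apply: eq_bigr => k _ /=; rewrite -mulrDr addrA subrK.
rewrite ltr_norml => /andP[H _]; rewrite (le_trans _ (ler_norm _)) //.
move: (S j l j y) (\sum_(k < n) _) H Hl => u v; lra.
Qed.

(** * Numerical conditions relating the block length to the number of levels *)

Section code_size.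
Variables (n p : nat).
Hypothesis np : (2 ^ (4 * (p + 2) ^ 2) <= n)%N.
Local Open Scope nat_scope.

Let n16 : 2 ^ 16 <= n.
Proof. by apply: leq_trans np; rewrite leq_exp2l //; lia. Qed.

(** Allows [K = (n ^ 2).-1] in [hierarchical_code], that is, a pigeonhole cost of [n ^ 2] per
    level. *)
Lemma digit_range_le : n * (2 * 2 ^ (2 * p)) ^ (2 * p) <= (n ^ 2).-1.
Proof.
have H : 2 * (2 * 2 ^ (2 * p)) ^ (2 * p) <= n.
  apply: leq_trans np; rewrite -expnS -expnM -expnS leq_exp2l //; nia.
rewrite -ltnS prednK; last by rewrite expn_gt0 (leq_trans _ n16).
have n0 : 0 < n by exact: leq_trans n16.
by rewrite expnS expn1 ltn_pmul2l //; have := expn_gt0 (2 * 2 ^ (2 * p)) (2 * p); nia.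
Qed.

(** Of the $2pn$ bits of a digit word, $n$ pay for [n ^ 2], $n$ for the choice of the disagreement
    set and $2n$ for the ball of radius [n %/ p]; this leaves $2(p-2)n$. *)
Lemma level_code_size : 2 < p ->
  2 ^ (2 * (p - 2) * n) * (n ^ 2).-1.+1 * (2 ^ n * (2 ^ (2 * p)) ^ (n %/ p)) <=
  (2 ^ (2 * p)) ^ n.
Proof.
move=> p2; have n0 : 0 < n by exact: leq_trans n16.
rewrite prednK ?expn_gt0 ?n0 //.
have n2 : n ^ 2 <= 2 ^ n.
  have : forall m, 4 <= m -> m ^ 2 <= 2 ^ m.
    elim=> // m IH; rewrite leq_eqVlt => /orP[/eqP <-//|]; rewrite ltnS => m4.
    by rewrite [X in _ <= X]expnS; have := IH m4; nia.
  by apply; exact: leq_trans n16.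
apply: (@leq_trans (2 ^ (2 * (p - 2) * n) * 2 ^ n * (2 ^ n * 2 ^ (2 * n)))).
  rewrite leq_mul ?leq_mul // -expnM leq_exp2l //.
  by rewrite -mulnA leq_mul2l /= mulnC leq_divM.
by rewrite -expnM -!expnD leq_exp2l //; nia.
Qed.

(** The Chebyshev condition at the least significant level, the worst one: $256=16^2$ comes from the
    threshold, [p ^ 2] from the distance $n/p$, and [(p + 3) ^ 2] from the error of a single
    test. *)
Lemma noise_budget :
  256 * p ^ 2 * (2 * 2 ^ (2 * p)) ^ (2 * p + 2) * (p + 3) ^ 2 <= n.
Proof.
apply: leq_trans np.
have p1 : p <= 2 ^ p by exact/ltnW/ltn_expl.
have p3 : p + 3 <= 2 ^ (p + 2) by rewrite expnD; lia.
apply: (@leq_trans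
  (2 ^ 8 * (2 ^ p) ^ 2 * (2 * 2 ^ (2 * p)) ^ (2 * p + 2) * (2 ^ (p + 2)) ^ 2)).
  by rewrite !leq_mul // leq_exp2r.
by rewrite -expnS -!expnM -!expnD leq_exp2l //; nia.
Qed.

End code_size.

(** For [p <= 2] the truncated [p - 2] makes the size 1, and a single codeword has no error
    condition to meet; hence the guarded hypothesis, which lets a code exist at every block
    length. *)
Lemma bernoulli_DI_code (R : realType) (n p : nat) :
  ((2 < p)%N -> (2 ^ (4 * (p + 2) ^ 2) <= n)%N) ->
  exists _ : DI_code (bernoulli_channel R) n ((2 ^ (2 * (p - 2) * n)) ^ p)
    (p + 3)%:R^-1 (p + 3)%:R^-1, True.
Proof.
have [p2|p2] := leqP p 2; move=> np.
  have N1 : ((2 ^ (2 * (p - 2) * n)) ^ p = 1)%N.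
    by have /eqP -> : (p - 2 == 0)%N by []; rewrite exp1n.
  rewrite N1; unshelve eexists (@DICode _ _ _ _ _ _ _ _ (fun=> [tuple 0%:i01 | _ < n])
    (fun=> finset.set0) _) => //.
  by move=> i j; rewrite !ord1 eqxx.
have {}np := np isT.
have [|c [c_lt c_sq c_sep]] :=
    hierarchical_code _ (digit_range_le np) (level_code_size np p2).
  by rewrite expn_gt0.
set b := (2 * 2 ^ (2 * p))%N in c_lt c_sq.
set N := ((2 ^ _) ^ p)%N in c c_lt c_sq c_sep *.
set r := (n %/ p)%N in c_sep.
have b0 : (0 < b)%N by rewrite muln_gt0 expn_gt0.
have noise : (256 * p ^ 2 * b ^ (2 * p + 2) * (p + 3) ^ 2 <= n)%N := noise_budget np.
clearbody b.
have B0 : 0 < b%:R :> R by rewrite ltr0n.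
pose low i k l : R := (low_part b (c i k) l)%:R.
have low0 i k l : 0 <= low i k l by exact: ler0n.
have low_le i k l : low i k l <= b%:R ^+ l.
  rewrite -natrX ler_nat; have := @low_part_lt b _ l (c_lt i k); lia.
have xge0 i k : 0 <= low i k p / b%:R ^+ p by rewrite divr_ge0 ?exprn_ge0 ?low0 // ltW.
have xle1 i k : low i k p / b%:R ^+ p <= 1 by rewrite ler_pdivrMr ?exprn_gt0 // mul1r.
pose x i : n.-tuple {i01 R} := [tuple Itv01 (xge0 i k) (xle1 i k) | k < n].
(* Half of the shift guaranteed when [l] is the top level of disagreement: more than [r] positions
   contribute $(b^l/2)^2$ each, divided by $2b^p$. *)
pose t (l : 'I_p) : R := r.+1%:R * b%:R ^+ (2 * l) / (16 * b%:R ^+ p).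
have t0 l : 0 < t l by rewrite divr_gt0 ?mulr_gt0 ?exprn_gt0 ?ltr0n.
have p30 : 0 < (p + 3)%:R :> R by rewrite ltr0n addn3.
(* The error $(p+3)^{-2}$ per test keeps the union over [p] tests below $1/(p+3)$. *)
apply: (@DI_code_of_linear_tests R n N p x (fun i l k => low i k l.+1) t ((p + 3)%:R ^- 2)) => //.
- rewrite expr2 invfM mulrA; apply: ler_piMl; first by rewrite invr_ge0 ltW.
  by rewrite ler_pdivrMr // mul1r ler_nat leq_addr.
- rewrite expr2 invfM; apply: ler_piMl; first by rewrite invr_ge0 ltW.
  by rewrite invf_le1 // ler1n addn3.
- move=> j l; apply: (@le_trans _ _ (n%:R * (b%:R ^+ l.+1) ^+ 2)).
    rewrite -[X in X%:R]card_ord mulr_natl -sumr_const; apply: ler_sum => k _.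
    by rewrite ler_pXn2r ?nnegrE ?exprn_ge0 ?low0 // ltW.
  move: noise; rewrite -(ler_nat R) !natrM !natrX => H.
  have rn : n%:R <= r.+1%:R * p%:R :> R.
    by rewrite -natrM ler_nat ltnW // ltn_ceil //; lia.
  have B1 : 1 <= b%:R ^+ l :> R by rewrite exprn_ege1 // ler1n.
  (* With denominators cleared, and [h] the left side of [noise], the claim is $n h b^{2l} \le
     ((r+1)p)^2 b^{4l}$, which follows from $h \le n \le (r+1)p$ and $1 \le b^l$. *)
  rewrite -(@ler_pM2r _ (256 * (p + 3)%:R ^+ 2 * b%:R ^+ (2 * p))); last first.
    by rewrite !mulr_gt0 ?exprn_gt0 // ltr0n.
  have -> : (p + 3)%:R ^- 2 * t l ^+ 2 * (256 * (p + 3)%:R ^+ 2 * b%:R ^+ (2 * p)) =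
      r.+1%:R ^+ 2 * b%:R ^+ (4 * l) :> R.
    rewrite /t [(2 * p)%N]mulnC [(2 * l)%N]mulnC exprM [(4 * l)%N]mulnC !exprM; field.
    by rewrite !gt_eqF ?exprn_gt0.
  have -> : n%:R * (b%:R ^+ l.+1) ^+ 2 * (256 * (p + 3)%:R ^+ 2 * b%:R ^+ (2 * p)) =
    n%:R * ((256 * p%:R ^+ 2 * b%:R ^+ (2 * p + 2) * (p + 3)%:R ^+ 2) *
            b%:R ^+ l ^+ 2 / p%:R ^+ 2) :> R.
    by rewrite [b%:R ^+ l.+1]exprS [b%:R ^+ (2 * p + 2)]exprD; field; rewrite pnatr_eq0; lia.
  move: H; set h := 256 * _ * _ * _ => H.
  have P0 : 0 < p%:R :> R by rewrite ltr0n; lia.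
  rewrite mulrA ler_pdivrMr ?exprn_gt0 //.
  have -> : r.+1%:R ^+ 2 * b%:R ^+ (4 * l) * p%:R ^+ 2 =
    (r.+1%:R * p%:R) * (r.+1%:R * p%:R) * (b%:R ^+ l ^+ 4) :> R.
    by rewrite [(4 * l)%N]mulnC exprM; ring.
  rewrite mulrA; apply: ler_pM => //.
  + by rewrite mulr_ge0 ?ler0n // /h !mulr_ge0 ?exprn_ge0 ?ler0n // ltW.
  + by apply: ler_pM => //; rewrite ?(le_trans H) // /h !mulr_ge0 ?exprn_ge0 ?ler0n // ltW.
  + exact: ler_weXn2l.
- move=> i j /[1!eq_sym] ij; have [l [lp rl agree]] := c_sep _ _ ij.
  exists (Ordinal lp) => /=.
  pose D k := low j k l.+1 - low i k l.+1.
  have diffE k : low j k p - low i k p = D k.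
    apply/eqP; rewrite /D subr_eq addrAC eq_sym subr_eq -!natrD eqr_nat; apply/eqP.
    by rewrite [LHS]addnC; apply: low_part_agree => // m lmp; rewrite agree.
  (* Polarization: equal norms turn the inner product with the difference into half its squared
     norm. *)
  have sumD : \sum_(k < n) low j k l.+1 * D k = (\sum_(k < n) D k ^+ 2) / 2.
    have : \sum_(k < n) low j k l.+1 ^+ 2 = \sum_(k < n) low i k l.+1 ^+ 2.
      have /(congr1 (fun m => m%:R : R)) := c_sq j i l lp.
      rewrite !natr_sum; under eq_bigr do rewrite natrX.
      by move=> ->; apply: eq_bigr => k _; rewrite natrX.
    move=> H; have -> : \sum_(k < n) D k ^+ 2 = \sum_(k < n) low j k l.+1 * D k * 2 -
        (\sum_(k < n) low j k l.+1 ^+ 2 - \sum_(k < n) low i k l.+1 ^+ 2).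
      by rewrite -!sumrB; apply: eq_bigr => k _; rewrite /D; ring.
    by rewrite H subrr subr0 -mulr_suml mulfK ?pnatr_eq0.
  have Dge k : c j k l != c i k l -> (b%:R ^+ l / 2) ^+ 2 <= D k ^+ 2.
    have gap (u v : 'I_(N)) : (c v k l < c u k l)%N ->
        b%:R ^+ l / 2 <= low u k l.+1 - low v k l.+1.
      move=> /(low_part_gap (c_lt v k)); rewrite -(ler_nat R) natrD !natrM natrX => H.
      rewrite ler_pdivrMr //; move: H; rewrite -!/(low _ _ _).
      move: (low u k l.+1) (low v k l.+1) (b%:R ^+ l) => u' v' w'; lra.
    have h0 : 0 <= b%:R ^+ l / 2 :> R by rewrite divr_ge0 // exprn_ge0 // ltW.
    case: (ltngtP (c j k l) (c i k l)) => // /gap H _.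
      by rewrite -[D k ^+ 2]sqrrN opprB ler_pXn2r // nnegrE (le_trans h0 H).
    by rewrite ler_pXn2r // nnegrE (le_trans h0 H).
  have -> : \sum_(k < n) low j k l.+1 * ((tnth (x j) k)%:num - (tnth (x i) k)%:num) =
      (\sum_(k < n) D k ^+ 2) / (2 * b%:R ^+ p).
    rewrite invfM mulrA -sumD mulr_suml; apply: eq_bigr => k _.
    by rewrite !tnth_mktuple /= -mulrBl diffE mulrA.
  have : r.+1%:R * (b%:R ^+ l / 2) ^+ 2 <= \sum_(k < n) D k ^+ 2.
    rewrite (bigID (fun k => c j k l != c i k l)) /= -[leLHS]addr0 lerD //; last first.
      by apply: sumr_ge0 => k _; exact: sqr_ge0.
    apply: (@le_trans _ _ (\sum_(k < n | c j k l != c i k l) (b%:R ^+ l / 2) ^+ 2)).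
      rewrite sumr_const -[leRHS]mulr_natl ler_wpM2r ?sqr_ge0 // ler_nat.
      by apply: leq_trans rl _; rewrite cardsE.
    exact: ler_sum.
  move: (\sum_(k < n) D k ^+ 2) => S HS; rewrite /t.
  rewrite [(2 * l)%N]mulnC exprM ler_pdivlMr ?mulr_gt0 ?exprn_gt0 //.
  apply: le_trans HS; rewrite le_eqVlt; apply/orP; left; apply/eqP; field.
  by rewrite gt_eqF ?exprn_gt0.
Qed.

(** * The number of levels as a function of the block length, and the limiting rate *)

Local Open Scope classical_set_scope.
Local Open Scope ring_scope.

(** Grows like $\sqrt{\log_2 n}/2$. The maximum is empty, hence 0, for $n < 2^{16}$. *)
Definition code_depth (n : nat) : nat :=
  \max_(i < n.+1 | (2 ^ (4 * (i + 2) ^ 2) <= n)%N) i.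

Lemma code_depth_le n : (0 < code_depth n)%N ->
  (2 ^ (4 * (code_depth n + 2) ^ 2) <= n)%N.
Proof.
rewrite /code_depth.
have [A0|A0] := posnP #|[pred i : 'I_n.+1 | 2 ^ (4 * (i + 2) ^ 2) <= n]%N|.
  by rewrite big_pred0 // => i; have := card0_eq A0 i; rewrite inE.
by have [i Hi ->] := bigop.eq_bigmax_cond (fun i : 'I_n.+1 => val i) A0.
Qed.

Lemma code_depth_gt n : (n < 2 ^ (4 * (code_depth n + 3) ^ 2))%N.
Proof.
rewrite ltnNge; apply/negP => H.
(* The next depth must lie in the index range of the maximum before it can contradict maximality. *)
have lt_n : ((code_depth n).+1 < n.+1)%N.
  rewrite ltnS; apply: leq_trans H; apply: leq_trans (ltn_expl (code_depth n) (isT : 1 < 2)%N) _.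
  by rewrite leq_exp2l //; nia.
have := @bigop.leq_bigmax_cond 'I_n.+1 (fun i : 'I_n.+1 => 2 ^ (4 * (i + 2) ^ 2) <= n)%N
  (fun i => val i) (Ordinal lt_n).
by rewrite -/(code_depth n) /= addSnnS => /(_ H); rewrite ltnn.
Qed.

Lemma cvg_inv_code_depth (R : realType) :
  ((code_depth n + 3)%:R^-1 : R) @[n --> \oo] --> (0 : R).
Proof.
have H : (fun n => code_depth n + 2)%N @ \oo --> \oo.
  apply/cvgnyPge => A; near=> n.
  rewrite leqNgt; apply/negP => lt_A.
  have : (n < 2 ^ (4 * (A + 1) ^ 2))%N.
    apply: leq_trans (code_depth_gt n) _; rewrite leq_exp2l // leq_mul2l leq_sqr /=; lia.
  by apply/negP; rewrite -leqNgt; near: n; exact: nbhs_infty_ge.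
have := cvg_comp _ _ H (@cvg_harmonic R).
rewrite (_ : _ \o _ = fun n => (code_depth n + 3)%:R^-1) //.
by apply/funext => n /=; rewrite -addnS.
Unshelve. all: by end_near.
Qed.

(** The rate is $2(p-2)p\ln 2/\ln n$ with $4(p+2)^2\ln 2 \le \ln n \le 4(p+3)^2\ln 2$ once $p>0$,
    which squeezes it between $1/2-4/(p+3)$ and $1/2$. *)
Lemma bernoulli_half_achievable (R : realType) :
  achievable_linearithmic_rate (bernoulli_channel R) (1 / 2).
Proof.
split; first by rewrite divr_gt0.
pose p := code_depth.
exists (fun n => (2 ^ (2 * (p n - 2) * n)) ^ p n)%N.
exists (fun n => (p n + 3)%:R^-1), (fun n => (p n + 3)%:R^-1).
have H n := @bernoulli_DI_code R n (p n) (fun p2 => code_depth_le (ltnW (ltnW p2))).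
exists (fun n => projT1 (cid (H n))); split; [exact: cvg_inv_code_depth..|].
apply: (@squeeze_cvgr _ _ _ _ (fun n => 1 / 2 - 4 * (p n + 3)%:R^-1) (fun=> 1 / 2)).
- near=> n.
  have n1 : (1 < n)%N by near: n; exact: nbhs_infty_gt.
  have n0 : (0 < n)%N := ltnW n1.
  have ln2 : 0 < ln 2 :> R by rewrite ln_gt0 // ltr1n.
  have lnn : 0 < ln n%:R :> R by rewrite ln_gt0 // ltr1n.
  have ln_upper : ln n%:R <= 4 * (p n + 3)%:R ^+ 2 * ln 2 :> R.
    have : ln n%:R <= ln (2 ^ (4 * (p n + 3) ^ 2))%:R :> R.
      by rewrite ler_ln ?posrE ?ltr0n ?expn_gt0 // ler_nat ltnW // code_depth_gt.
    by rewrite natrX lnXn // -[ln _ *+ _]mulr_natl natrM natrX.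
  have [p0|p0] := posnP (p n).
    rewrite p0 expn0 ln1 mul0r; apply/andP; split; last by rewrite divr_ge0.
    by rewrite add0n; lra.
  have ln_lower : 4 * (p n + 2)%:R ^+ 2 * ln 2 <= ln n%:R :> R.
    have : ln (2 ^ (4 * (p n + 2) ^ 2))%:R <= ln n%:R :> R.
      by rewrite ler_ln ?posrE ?ltr0n ?expn_gt0 // ler_nat code_depth_le.
    by rewrite natrX lnXn // -[ln _ *+ _]mulr_natl natrM natrX.
  have -> : ln ((2 ^ (2 * (p n - 2) * n)) ^ p n)%:R / (n%:R * ln n%:R) =
     2 * (p n - 2)%:R * (p n)%:R * ln 2 / ln n%:R :> R.
    rewrite -expnM natrX lnXn // -[ln _ *+ _]mulr_natl !natrM; field.
    by rewrite pnatr_eq0 gt_eqF //=; lia.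
  have P0 : 1 <= (p n)%:R :> R by rewrite ler1n.
  have Q1 : (p n)%:R - 2 <= (p n - 2)%:R :> R.
    by rewrite lerBlDr -natrD ler_nat; lia.
  have Q2 : (p n - 2)%:R <= (p n)%:R :> R by rewrite ler_nat; lia.
  have Q0 : 0 <= (p n - 2)%:R :> R by exact: ler0n.
  move: ln_upper ln_lower; rewrite !natrD; move: Q1 Q2 P0 Q0 lnn ln2.
  move: ((p n)%:R : R) ((p n - 2)%:R : R) (ln n%:R) (ln 2).
  move=> P P2 T l Q1 Q2 P0 Q0 T0 l0 U L.
  apply/andP; split.
    have P3 : 0 < P + 3 by lra.
    have -> : 1 / 2 - 4 / (P + 3) = (P - 5) / (2 * (P + 3)) by field; rewrite gt_eqF.
    rewrite ler_pdivlMr // mulrAC ler_pdivrMr ?mulr_gt0 //.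
    (* For [P <= 5] the lower bound is nonpositive; beyond, [ln_upper] may be multiplied by
       [P - 5]. *)
    have [P5|P5] := leP P 5.
      apply: (@le_trans _ _ 0); last by rewrite !mulr_ge0 // ltW //; lra.
      by rewrite mulr_le0_ge0 ?subr_le0 // ltW.
    apply: (@le_trans _ _ ((P - 5) * (4 * (P + 3) ^+ 2 * l))).
      by rewrite ler_wpM2l // subr_ge0 ltW.
    rewrite [leRHS](_ : _ = P2 * (4 * P * l * (P + 3))); last by ring.
    apply: (@le_trans _ _ ((P - 2) * (4 * P * l * (P + 3)))); last first.
      by rewrite ler_wpM2r // !mulr_ge0 // ltW //; lra.
    rewrite -subr_ge0.
    have -> : (P - 2) * (4 * P * l * (P + 3)) - (P - 5) * (4 * (P + 3) ^+ 2 * l) =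
      60 * (l * (P + 3)) by ring.
    by rewrite !mulr_ge0 // ltW.
  rewrite ler_pdivrMr //.
  have : P2 * P <= (P + 2) ^+ 2 by nra.
  move=> /(ler_wpM2r (ltW l0)); lra.
- rewrite -[X in _ --> X]subr0 -[X in _ - X](mulr0 4); apply: cvgB; first exact: cvg_cst.
  by apply: cvgMr; exact: cvg_inv_code_depth.
- exact: cvg_cst.
Unshelve. all: by end_near.
Qed.

(** * Converse *)

Section testing.
Variables (R : realType) (X : Type) (Y : finType) (W : channel R X Y).
Variables (n : nat) (x x' : n.-tuple X).

Definition bhattacharyya (a a' : X) : R :=
  \sum_(b : Y) Num.sqrt (W a b) * Num.sqrt (W a' b).

(** The coefficient is multiplicative over coordinates. Its sum is split over [D] and the
    complement, and on each part one of the two laws has small mass. *)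
Lemma testing_bhattacharyya (D : {set n.-tuple Y}) (e1 e2 : R) :
  1 - e1 <= channel_pow W x D -> channel_pow W x' D <= e2 ->
  \prod_(k < n) bhattacharyya (tnth x k) (tnth x' k) <= 1 / 4 + 2 * (e1 + e2).
Proof.
move=> H1 H2.
rewrite -(sum_tuple_prod (fun k b => Num.sqrt (W (tnth x k) b) * Num.sqrt (W (tnth x' k) b))).
pose s (z : n.-tuple X) (y : n.-tuple Y) : R := \prod_(k < n) Num.sqrt (W (tnth z k) (tnth y k)).
have s2 z y : s z y ^+ 2 = \prod_(k < n) W (tnth z k) (tnth y k).
  by rewrite -prodrXl; apply: eq_bigr => k _; rewrite sqr_sqrtr // transition_ge0.
under eq_bigr do rewrite big_split /= -!/(s _ _).
have split z (A : {set n.-tuple Y}) : \sum_(y in A) s z y ^+ 2 = channel_pow W z A.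
  by apply: eq_bigr => y _; rewrite s2.
have pow_le1 (z : n.-tuple X) A : channel_pow W z A <= 1.
  by rewrite -(channel_powT W z) le_channel_pow // finset.subsetT.
(* Weighted so that the law of small mass gets the factor 2 and the other one $1/8$; the two parts
   give $1/4$ in total. *)
have amgm (A : {set n.-tuple Y}) z z' : \sum_(y in A) s z y * s z' y <=
    channel_pow W z A / 8 + 2 * channel_pow W z' A.
  rewrite -!split mulr_suml mulr_sumr -big_split /=; apply: ler_sum => y _.
  have := sqr_ge0 (s z y - 4 * s z' y); nra.
have notD y : (y \notin D) = (y \in (~: D)%SET) by rewrite inE.
rewrite (bigID (mem D)) /= (eq_bigl _ _ notD).
have := amgm D x x'; have := amgm (~: D)%SET x' x.
rewrite (eq_bigr (fun y => s x y * s x' y)) => [|y _]; last by rewrite mulrC.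
have := pow_le1 x D; have := pow_le1 x' (~: D)%SET; rewrite !(channel_powC W x).
move: H1 H2; move: (channel_pow W x D) (channel_pow W x' D) (channel_pow W x' (~: D)%SET).
move=> u v w; move: (\sum_(y in D) _) (\sum_(y in (~: D)%SET) _) => S T; lra.
Qed.

End testing.

(** The dot product of unit vectors is 1 minus half their squared distance, and in the octant $0 \le
    u \le v$ the circle is the graph of a 1-Lipschitz function of $u$. *)
Lemma circle_dot_ge (R : realFieldType) (u v u' v' : R) :
  0 <= u -> u <= v -> 0 <= u' -> u' <= v' ->
  u ^+ 2 + v ^+ 2 = 1 -> u' ^+ 2 + v' ^+ 2 = 1 ->
  1 - (u - u') ^+ 2 <= u * u' + v * v'.
Proof.
move=> u0 uv u0' uv' h h'.
have v0 : 0 < v + v' by nra.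
suff : (v - v') ^+ 2 <= (u - u') ^+ 2 by nra.
rewrite -(ler_pM2r (exprn_gt0 2 v0)) -exprMn.
have -> : (v - v') * (v + v') = - ((u - u') * (u + u')).
  have : v ^+ 2 - v' ^+ 2 = u' ^+ 2 - u ^+ 2 by lra.
  nra.
rewrite sqrrN exprMn ler_wpM2l ?sqr_ge0 // ler_pXn2r ?nnegrE //; lra.
Qed.

Lemma prod_ge_sub (R : realDomainType) (n : nat) (f : 'I_n -> R) (e : R) :
  0 <= e -> (forall k, 1 - e <= f k) -> e <= 1 -> 1 - n%:R * e <= \prod_(k < n) f k.
Proof.
move=> e0; elim: n f => [|n IH] f fe e1; first by rewrite big_ord0 mul0r subr0.
rewrite big_ord_recl.
have := IH (fun k => f (lift ord0 k)) (fun k => fe _) e1.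
have : 0 <= \prod_(k < n) f (lift ord0 k).
  by apply: prodr_ge0 => k _; apply: le_trans (fe _); rewrite subr_ge0.
have := fe ord0; rewrite -natr1.
have : 0 <= n%:R * e by rewrite mulr_ge0.
have : 0 <= n%:R :> R by exact: ler0n.
move: (\prod_(k < n) _) (f ord0) (n%:R : R) => p a m; nra.
Qed.

Section cells.
Variable R : realType.
Local Notation B := (bernoulli_channel R).

(** The smaller coordinate of the unit vector $(\sqrt a, \sqrt{1-a})$, as [circle_dot_ge]
    requires. *)
Definition amplitude (a : {i01 R}) : R := Num.sqrt (Num.min a%:num (1 - a%:num)).

(** Inputs in the same half of the interval give unit vectors in the same octant. *)
Lemma bhattacharyya_bernoulli_ge (a a' : {i01 R}) :
  (a%:num <= 1 / 2) = (a'%:num <= 1 / 2) ->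
  1 - (amplitude a - amplitude a') ^+ 2 <= bhattacharyya B a a'.
Proof.
have a0 : 0 <= a%:num :> R by []. have a1 : a%:num <= 1 :> R by [].
have a0' : 0 <= a'%:num :> R by []. have a1' : a'%:num <= 1 :> R by [].
rewrite /bhattacharyya big_bool /= /amplitude.
have sq (z : R) : 0 <= z -> Num.sqrt z ^+ 2 = z by exact: sqr_sqrtr.
case: leP => h /esym; [move=> h' | move=> /negbT; rewrite -ltNge => h'].
  rewrite (min_l (_ : a%:num <= 1 - a%:num)) ?(min_l (_ : a'%:num <= 1 - a'%:num)); [|lra|lra].
  apply: circle_dot_ge; rewrite ?sqrtr_ge0 ?sq ?ler_wsqrtr //; lra.
rewrite (min_r (_ : 1 - a%:num <= a%:num)) ?(min_r (_ : 1 - a'%:num <= a'%:num)); [|lra|lra].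
rewrite addrC; apply: circle_dot_ge; rewrite ?sqrtr_ge0 ?sq ?ler_wsqrtr //; lra.
Qed.

(** In a common cell amplitudes differ by at most $1/(2\sqrt n)$, so each coefficient is at least
    $1-1/(4n)$ and their product at least $3/4$, more than [testing_bhattacharyya] allows. Hence
    codewords have distinct cell sequences. *)
Lemma bernoulli_DI_code_size (n N : nat) (e1 e2 : R) : (0 < n)%N ->
  DI_code B n N e1 e2 -> e1 + e2 < 1 / 4 -> N%:R <= (6 * Num.sqrt n%:R) ^+ n :> R.
Proof.
move=> n0 [u D HD] e12.
pose s : R := Num.sqrt n%:R.
have n0R : 0 < n%:R :> R by rewrite ltr0n.
have s2 : s ^+ 2 = n%:R by rewrite sqr_sqrtr // ltW.
have s1 : 1 <= s by rewrite -sqrtr1 ler_wsqrtr // ler1n.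
pose m := Num.truncn (2 * s).
have scaled_ge0 a : 0 <= 2 * s * amplitude a by rewrite !mulr_ge0 ?sqrtr_ge0.
have amp1 a : amplitude a <= 1.
  by rewrite -sqrtr1 ler_wsqrtr // ge_min; apply/orP; left.
pose cell (a : {i01 R}) : bool * 'I_m.+1 :=
  (a%:num <= 1 / 2, inord (Num.truncn (2 * s * amplitude a))).
pose cells i : {ffun 'I_n -> bool * 'I_m.+1} := [ffun k => cell (tnth (u i) k)].
have cell_close a a' : cell a = cell a' -> 1 - (4 * n%:R)^-1 <= bhattacharyya B a a'.
  move=> [h /(congr1 val) /=].
  have tr z : (Num.truncn (2 * s * amplitude z) < m.+1)%N.
    by rewrite ltnS le_truncn // ler_piMr ?mulr_ge0 ?sqrtr_ge0.
  rewrite !inordK // => t.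
  apply: le_trans (bhattacharyya_bernoulli_ge h); rewrite lerD2l lerN2.
  have /andP[l1 r1] := truncn_itv (scaled_ge0 a).
  have /andP[l2 r2] := truncn_itv (scaled_ge0 a').
  rewrite t in l1 r1; move: (Num.truncn _) l1 r1 l2 r2 => z l1 r1 l2 r2.
  rewrite -(natr1 z) in r1; rewrite -(natr1 z) in r2.
  rewrite -(@ler_pM2l _ (4 * n%:R)) ?mulr_gt0 // divff ?gt_eqF ?mulr_gt0 //.
  have -> : 4 * n%:R * (amplitude a - amplitude a') ^+ 2 =
      (2 * s * amplitude a - 2 * s * amplitude a') ^+ 2 by rewrite -s2; ring.
  move: (2 * s * amplitude a) (2 * s * amplitude a') l1 r1 l2 r2 => v w l1 r1 l2 r2.
  suff : 0 <= (1 - (v - w)) * (1 + (v - w)) by lra.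
  by apply: mulr_ge0; lra.
have inj : injective cells.
  move=> i j /ffunP ij; apply/eqP; apply: contraTT isT => neq.
  have [H1 _] := HD _ _ neq; have [|_ H2] := HD j i; first by rewrite eq_sym.
  have := testing_bhattacharyya H1 H2.
  have : 1 - n%:R * (4 * n%:R)^-1 <=
      \prod_(k < n) bhattacharyya B (tnth (u i) k) (tnth (u j) k).
    apply: prod_ge_sub => [|k|].
    - by rewrite invr_ge0 mulr_ge0 // ltW.
    - by apply: cell_close; have := ij k; rewrite !ffunE.
    - by rewrite invf_le1 ?mulr_gt0 // -natrM ler1n muln_gt0 n0.
  have -> : n%:R * (4 * n%:R)^-1 = 1 / 4 :> R by field; rewrite gt_eqF.
  move: (\prod_(k < n) _) => q; lra.
have := leq_card _ inj; rewrite card_ord card_ffun card_prod card_bool !card_ord.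
rewrite -(ler_nat R) natrX => /le_trans; apply.
(* Each coordinate has $2(m+1) \le 4s+2 \le 6s$ cells, as $s \ge 1$. *)
rewrite ler_pXn2r ?nnegrE ?ler0n ?mulr_ge0 ?sqrtr_ge0 // natrM -(natr1 m).
have : m%:R <= 2 * s by rewrite truncn_le // mulr_ge0 ?sqrtr_ge0.
rewrite -/s; move: (m%:R : R) => z; lra.
Qed.

End cells.

(** The size bound gives $\ln N \le n(\ln 6+\frac12\ln n)$, and $\ln 6 \le e\ln n$ eventually. *)
Lemma bernoulli_rate_le_half (R : realType) (r : R) :
  achievable_linearithmic_rate (bernoulli_channel R) r -> r <= 1 / 2.
Proof.
move=> [_ [N [e1 [e2 [code [he1 he2 hr]]]]]].
apply/ler_addgt0Pr => e e0; apply: (cvgr_to_le hr).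
have ln6 : 0 < ln 6 :> R by rewrite ln_gt0 // ltr1n.
near=> n.
have n1 : (1 < n)%N by near: n; exact: nbhs_infty_gt.
have n0 : (0 < n)%N := ltnW n1.
have n0R : 0 < n%:R :> R by rewrite ltr0n.
have lnn : 0 < ln n%:R :> R by rewrite ln_gt0 // ltr1n.
have e1n : e1 n < 1 / 8 by near: n; apply: (cvgr_lt _ he1); rewrite divr_gt0.
have e2n : e2 n < 1 / 8 by near: n; apply: (cvgr_lt _ he2); rewrite divr_gt0.
have ln_large : ln 6 / e <= ln n%:R.
  rewrite -[leLHS]expRK ler_ln ?posrE ?expR_gt0 //.
  by near: n; exact: nbhs_infty_ger.
have size : (N n)%:R <= (6 * Num.sqrt n%:R) ^+ n :> R.
  by apply: (bernoulli_DI_code_size n0 (code n)); lra.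
rewrite ler_pdivrMr ?mulr_gt0 //.
(* An empty code has [ln 0 = 0] by convention. *)
have [->|N0] := posnP (N n).
  by rewrite ln0 // mulr_ge0 ?addr_ge0 ?mulr_ge0 ?divr_ge0 // ltW.
have sq0 : 0 < Num.sqrt n%:R :> R by rewrite sqrtr_gt0.
apply: (@le_trans _ _ (n%:R * (ln 6 + ln n%:R / 2))).
  have -> : ln 6 + ln n%:R / 2 = ln (6 * Num.sqrt n%:R) :> R.
    rewrite lnM ?posrE //; congr (_ + _).
    rewrite -{1}(sqr_sqrtr (ltW n0R)) lnXn // -[ln _ *+ _]mulr_natl; by field.
  rewrite mulr_natl -lnXn ?mulr_gt0 // ler_ln ?posrE ?ltr0n ?exprn_gt0 ?mulr_gt0 //.
rewrite [leRHS](_ : _ = n%:R * ((1 / 2 + e) * ln n%:R)); last by ring.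
rewrite ler_wpM2l ?ler0n //.
move: ln_large; rewrite ler_pdivrMr //; lra.
Unshelve. all: by end_near.
Qed.

Theorem corollary9 (R : realType) :
  is_linearithmic_DI_capacity (bernoulli_channel R) (1 / 2).
Proof.
split; first exact: bernoulli_half_achievable.
by move=> r; exact: bernoulli_rate_le_half.
Qed.
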